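(* Let $0<T<\infty$ and let $\xi\in S_0([0,T])$ be a driver with conformal welding $\varphi=\varphi(\cdot;\xi):[-a,0]\to[0,b]$. If $x\in(-a,0]$ and $\epsilon>0$, there exists $\delta=\delta(\epsilon,x,\xi)>0$ such that whenever $\tilde x\le0$ and $\tilde\xi\in S_0([0,T])$ satisfy $$\max\{|\tilde x-x|,\ \|\tilde\xi-\xi\|_{\infty[0,T]}\}<\delta,$$ then ($\varphi(\tilde x;\tilde\xi)$ is defined and) $$|\varphi(\tilde x;\tilde\xi)-\varphi(x;\xi)|<\epsilon.$$
   Context: A driver is a continuous function $\xi:[0,T]\to\mathbb{R}$. The upwards Loewner flow of $\xi$ in the upper half plane $\mathbb{H}$ is the solution of $\partial_t h_t(z)=\frac{-2}{h_t(z)-\xi(t)}$, $h_0(z)=z$; for $z\in\mathbb{H}$ it exists on all of $[0,T]$. Hitting times: for $x\in\mathbb{R}\setminus\{\xi(0)\}$, let $x(t)=h_t(x;\xi)$ be the real solution of the same ODE started at $x$, and let $\tau(x;\xi):=\inf\{t\ge 0: \liminf_{s\nearrow t}|x(s)-\xi(s)|=0\}$ (with $t\in[0,T]$ and $\inf\emptyset=+\infty$); also $\tau(\xi(0);\xi)=0$. Simple-curve drivers: $S([0,T])$ is the set of continuous $\xi:[0,T]\to\mathbb{R}$ that generate a simple curve, i.e. there is an injective continuous $\gamma:[0,T]\to\mathbb{H}\cup\{\xi(T)\}$ with $\gamma(0)=\xi(T)$ and $\gamma((0,T])\subset\mathbb{H}$ such that $h_T$ maps $\mathbb{H}$ conformally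 onto $\mathbb{H}\setminus\gamma((0,T])$. $S_0([0,T])$ is the set of $\xi\in S([0,T])$ with $\xi(0)=0$. Conformal welding: for $\xi\in S_0([0,T])$, $T<\infty$, the hitting time function is finite exactly on a compact interval $[-a,b]$ with $-a<0<b$, is continuous there, strictly decreasing on $[-a,0]$ and strictly increasing on $[0,b]$, with $\tau(-a)=\tau(b)=T$. With $\tau_-=\tau|_{[-a,0]}$, $\tau_+=\tau|_{[0,b]}$, the conformal welding of $\xi$ is the homeomorphism $\varphi(\cdot;\xi)=\tau_+^{-1}\circ\tau_-:[-a,0]\to[0,b]$, i.e. $\tau(x)=\tau(\varphi(x))$. *)

(* Defs.v *)
From Stdlib Require Import Reals.
From Coquelicot Require Import Coquelicot.

Open Scope R_scope.

Definition Icc (a b : R) (x : R) : Prop := a <= x <= b.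

Definition upper_half_plane (z : C) : Prop := 0 < Im z.

(* Drivers are total functions [R -> R] of which only the values on [0,T]
   matter; continuity is relative to [0,T]. *)
Definition driver (T : R) (xi : R -> R) : Prop := continuous_on (Icc 0 T) xi.

(* The equation holds on the open interval and the solution is continuous on
   the closed one; since the right-hand side is continuous, this amounts to the
   equation with one-sided derivatives at 0 and T. The condition
   [w t <> xi t] is needed because division by 0 is total. *)
Definition loewner_solution_C (T : R) (xi : R -> R) (z : C) (w : R -> C) : Prop :=
  w 0 = z /\
  continuous_on (T := R_UniformSpace) (U := C_UniformSpace) (Icc 0 T) w /\
  (forall t, 0 <= t <= T -> w t <> RtoC (xi t)) /\
  (forall t, 0 < t < T ->
     is_derive (K := R_AbsRing) (V := C_R_NormedModule) w t
       (RtoC (-2) / (w t - RtoC (xi t)))%C).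

Definition loewner_flow (T : R) (xi : R -> R) (h : R -> C -> C) : Prop :=
  forall z, upper_half_plane z -> loewner_solution_C T xi z (fun t => h t z).

(* Real solution on the half-open interval [0,t). *)
Definition loewner_solution_R (t : R) (xi : R -> R) (x : R) (u : R -> R) : Prop :=
  u 0 = x /\
  continuous_on (fun s => 0 <= s < t) u /\
  (forall s, 0 <= s < t -> u s <> xi s) /\
  (forall s, 0 < s < t -> is_derive u s (-2 / (u s - xi s))).

(* [is_LimInf_left f t l]: the lower limit of [f s] as [s] increases to [t] is
   [l]; same shape as [is_LimInf_seq] for a finite limit. *)
Definition is_LimInf_left (f : R -> R) (t l : R) : Prop :=
  forall eps : posreal,
    (forall d : posreal, exists s, t - d < s < t /\ f s < l + eps) /\
    (exists d : posreal, forall s, t - d < s < t -> l - eps < f s).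

(* For x <> xi(0) there is no left limit at time 0, so t ranges over (0,T].
   [Glb_Rbar] of the empty set is [p_infty]. *)
Definition hitting_time (T : R) (xi : R -> R) (x : R) : Rbar :=
  if Req_dec_T x (xi 0) then Finite 0
  else Glb_Rbar (fun t => 0 < t <= T /\
         exists u, loewner_solution_R t xi x u /\
                   is_LimInf_left (fun s => Rabs (u s - xi s)) t 0).

Definition conformal_onto (D E : C -> Prop) (f : C -> C) : Prop :=
  (forall z, D z -> ex_derive (K := C_AbsRing) (V := C_NormedModule) f z) /\
  (forall z1 z2, D z1 -> D z2 -> f z1 = f z2 -> z1 = z2) /\
  (forall w, E w <-> exists z, D z /\ f z = w).

Definition simple_curve_driver (T : R) (xi : R -> R) : Prop :=
  driver T xi /\
  exists (h : R -> C -> C) (gamma : R -> C),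
    loewner_flow T xi h /\
    continuous_on (T := R_UniformSpace) (U := C_UniformSpace) (Icc 0 T) gamma /\
    (forall s t, 0 <= s <= T -> 0 <= t <= T -> gamma s = gamma t -> s = t) /\
    gamma 0 = RtoC (xi T) /\
    (forall t, 0 < t <= T -> upper_half_plane (gamma t)) /\
    conformal_onto upper_half_plane
      (fun w => upper_half_plane w /\ ~ exists t, 0 < t <= T /\ gamma t = w)
      (h T).

Definition simple_curve_driver0 (T : R) (xi : R -> R) : Prop :=
  simple_curve_driver T xi /\ xi 0 = 0.

Definition homeomorphism_on (A B : R -> Prop) (f : R -> R) : Prop :=
  (forall x, A x -> B (f x)) /\ continuous_on A f /\
  exists g : R -> R,
    (forall y, B y -> A (g y)) /\ continuous_on B g /\
    (forall x, A x -> g (f x) = x) /\ (forall y, B y -> f (g y) = y).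

(* [phi] restricted to [-a,0] is the welding of [xi], where [-a,b] is the set
   of points with finite hitting time. As [phi x] lies in [0,b], the last
   equation says tau_+(phi x) = tau_-(x). Values of [phi] outside [-a,0] are
   irrelevant. *)
Definition is_conformal_welding (T : R) (xi : R -> R) (a b : R) (phi : R -> R)
  : Prop :=
  0 < a /\ 0 < b /\
  (forall x, is_finite (hitting_time T xi x) <-> - a <= x <= b) /\
  homeomorphism_on (Icc (- a) 0) (Icc 0 b) phi /\
  (forall x, - a <= x <= 0 -> hitting_time T xi (phi x) = hitting_time T xi x).

Definition sup_norm (T : R) (f : R -> R) : Rbar :=
  Lub_Rbar (fun r => exists t, 0 <= t <= T /\ r = Rabs (f t)).

(* Main.v *)
Require Import Defs.
From Stdlib Require Import Reals Lra Lia Classical.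
From Coquelicot Require Import Coquelicot.

(** Write tau for the hitting time under xi and tau' for that under xi'. The
    welding is continuous in (x, xi) because hitting times are monotone, and a
    perturbation of the driver can be traded for a perturbation of the point.

    To the left of the driver points move to the right, and for two solutions
    u <= v of equations with drivers xi >= eta the gap v - u does not decrease
    ([gap_nondecreasing]). Consequently a point that starts higher and faces a
    lower driver is absorbed no later, and two different points with the same
    driver cannot be absorbed simultaneously. As the equation is invariant under
    a common translation of point and driver, a bound |xi' - xi| <= delta gives
    tau (z + delta) <= tau' z <= tau (z - delta) for points on the left
    ([reaches_shift_left]), and by reflection the same with reversed signs on
    the right ([reaches_shift_right]). On each side tau is strictly monotone
    ([reaches_strict_left], [reaches_strict_right]).

    For x' within delta of x this sandwiches tau' x' between tau (x + 2 delta)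
    and tau (x - 2 delta), which are the values of tau at phi (x + 2 delta) and
    phi (x - 2 delta). These points are within eps/2 of phi x by continuity of
    phi. The point phi' x' has the hitting time tau' x', so if it were eps away
    from phi x, the sandwich and the strict monotonicity of tau on the right of
    0 would contradict each other. For x = 0 the lower bound is trivial, since
    phi 0 = 0.

    The upper bound for tau' x' includes the claim that x' is hit at all, which
    requires real solutions up to the absorption time
    ([absorbed_or_survives]). They are glued from solutions of truncated,
    globally Lipschitz equations, for which Picard iteration converges. *)

Open Scope R_scope.

(** * Continuity relative to an interval *)

Lemma continuous_on_eps (D : R -> Prop) (f : R -> R) :
  continuous_on D f <->
  (forall x, D x -> forall e, 0 < e -> exists d, 0 < d /\
     forall y, D y -> Rabs (y - x) < d -> Rabs (f y - f x) < e).
Proof.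
  split.
  - intros H x Dx e He.
    destruct (H x Dx (ball (f x) (mkposreal e He))) as [d Hd].
    { exact (locally_ball (f x) (mkposreal e He)). }
    exists d; split; [apply cond_pos|].
    intros y Dy Hy. exact (Hd y Hy Dy).
  - intros H x Dx P [e He].
    destruct (H x Dx e (cond_pos e)) as [d [Hd Hy]].
    exists (mkposreal d Hd). intros y Hxy Dy.
    apply He. exact (Hy y Dy Hxy).
Qed.

Lemma continuous_on_minus (D : R -> Prop) (f g : R -> R) :
  continuous_on D f -> continuous_on D g ->
  continuous_on D (fun x => f x - g x).
Proof.
  intros Hf Hg x Dx.
  apply (filterlim_comp_2 (G := locally (f x)) (H := locally (- g x))
           (fun x => f x) (fun x => - g x) Rplus).
  - exact (Hf x Dx).
  - apply (filterlim_comp _ _ _ g Ropp _ (locally (g x))).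
    + exact (Hg x Dx).
    + exact (filterlim_opp (V := R_NormedModule) (g x)).
  - exact (filterlim_plus (V := R_NormedModule) (f x) (- g x)).
Qed.

Lemma continuous_on_mult (D : R -> Prop) (f g : R -> R) :
  continuous_on D f -> continuous_on D g ->
  continuous_on D (fun x => f x * g x).
Proof.
  intros Hf Hg x Dx.
  apply (filterlim_comp_2 (G := locally (f x)) (H := locally (g x))
           (fun x => f x) (fun x => g x) Rmult).
  - exact (Hf x Dx).
  - exact (Hg x Dx).
  - exact (filterlim_mult (K := R_AbsRing) (f x) (g x)).
Qed.

Lemma is_derive_continuous (f : R -> R) (x l : R) :
  is_derive f x l -> continuous f x.
Proof.
  intros H. apply (ex_derive_continuous (V := R_NormedModule) f x).
  exists l. exact H.
Qed.

(** Precomposing with the retraction of the line onto [a, b] turns continuity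
    relative to [a, b] into continuity at every point, which the classical
    one-variable theorems (mean value, extreme value, intermediate value)
    expect. *)
Definition clamp (a b s : R) : R := Rmax a (Rmin b s).

Lemma clamp_id (a b s : R) : a <= s <= b -> clamp a b s = s.
Proof. intros H. unfold clamp, Rmax, Rmin. repeat destruct Rle_dec; lra. Qed.

Lemma clamp_in (a b s : R) : a <= b -> a <= clamp a b s <= b.
Proof. intros H. unfold clamp, Rmax, Rmin. repeat destruct Rle_dec; lra. Qed.

Lemma clamp_contracting (a b s r : R) :
  Rabs (clamp a b s - clamp a b r) <= Rabs (s - r).
Proof.
  unfold clamp, Rmax, Rmin, Rabs.
  repeat destruct Rle_dec; repeat destruct Rcase_abs; lra.
Qed.

Lemma continuous_clamp_comp (a b : R) (f : R -> R) :
  a <= b -> continuous_on (Icc a b) f ->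
  forall s, continuous (fun r => f (clamp a b r)) s.
Proof.
  intros Hab H s P [e He].
  destruct (proj1 (continuous_on_eps _ f) H (clamp a b s) (clamp_in a b s Hab)
              e (cond_pos e)) as [d [Hd Hy]].
  exists (mkposreal d Hd). intros y Hsy. apply He.
  apply Hy; [apply clamp_in, Hab|].
  eapply Rle_lt_trans; [apply clamp_contracting|exact Hsy].
Qed.

Lemma clamp_locally_id (a b s : R) :
  a < s < b -> locally s (fun r => clamp a b r = r).
Proof.
  intros [H1 H2].
  assert (Hd : 0 < Rmin (s - a) (b - s)) by (apply Rmin_pos; lra).
  exists (mkposreal _ Hd). intros r Hr. apply clamp_id.
  change (Rabs (r - s) < Rmin (s - a) (b - s)) in Hr.
  apply Rabs_lt_between in Hr.
  pose proof (Rmin_l (s - a) (b - s)). pose proof (Rmin_r (s - a) (b - s)).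
  lra.
Qed.

Lemma nondecreasing_of_derive (a b : R) (f df : R -> R) :
  a <= b -> continuous_on (Icc a b) f ->
  (forall s, a < s < b -> is_derive f s (df s)) ->
  (forall s, a < s < b -> 0 <= df s) -> f a <= f b.
Proof.
  intros Hab Hc Hd Hp.
  (* The mean value point may be an endpoint, where df is arbitrary; there the
     derivative is replaced by 0. *)
  destruct (MVT_gen (fun r => f (clamp a b r)) a b
    (fun s => if Rlt_dec a s then if Rlt_dec s b then df s else 0 else 0))
    as [c [_ E]].
  - rewrite Rmin_left, Rmax_right by assumption. intros s Hs.
    destruct (Rlt_dec a s); [|lra]. destruct (Rlt_dec s b); [|lra].
    apply (is_derive_ext_loc f); [|apply Hd, Hs].
    generalize (clamp_locally_id a b s Hs). apply filter_imp.
    intros q Hq. rewrite Hq. reflexivity.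
  - intros s _. apply continuity_pt_filterlim.
    apply (continuous_clamp_comp a b f Hab Hc s).
  - rewrite !clamp_id in E by lra.
    assert (0 <= (if Rlt_dec a c then if Rlt_dec c b then df c else 0 else 0)).
    { destruct (Rlt_dec a c); [|lra]. destruct (Rlt_dec c b); [|lra]. auto. }
    assert (0 <= f b - f a) by (rewrite E; apply Rmult_le_pos; lra). lra.
Qed.

Lemma positive_bounded_below (a b : R) (f : R -> R) :
  a <= b -> continuous_on (Icc a b) f ->
  (forall s, a <= s <= b -> 0 < f s) ->
  exists m, 0 < m /\ forall s, a <= s <= b -> m <= f s.
Proof.
  intros Hab Hc Hp.
  destruct (continuity_ab_min (fun r => f (clamp a b r)) a b Hab) as [m [Hm Im]].
  - intros s _. apply continuity_pt_filterlim.
    apply (continuous_clamp_comp a b f Hab Hc s).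
  - exists (f m). split; [apply Hp, Im|].
    intros s Hs. generalize (Hm s Hs). rewrite !clamp_id by assumption. auto.
Qed.

Lemma positive_of_nonzero (a b : R) (f : R -> R) :
  a <= b -> continuous_on (Icc a b) f ->
  (forall s, a <= s <= b -> f s <> 0) -> 0 < f a -> 0 < f b.
Proof.
  intros Hab Hc Hn Ha.
  destruct (Rlt_le_dec 0 (f b)) as [|Hb]; [assumption|exfalso].
  destruct (IVT_gen (fun r => f (clamp a b r)) a b 0) as [c [Ic Ec]].
  - intros s. apply continuity_pt_filterlim.
    apply (continuous_clamp_comp a b f Hab Hc s).
  - rewrite !clamp_id by lra. rewrite Rmin_right, Rmax_left by lra. lra.
  - exact (Hn _ (clamp_in a b c Hab) Ec).
Qed.

Lemma continuous_on_near_lt (D : R -> Prop) (f : R -> R) (s c : R) :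
  continuous_on D f -> D s -> f s < c ->
  exists d, 0 < d /\ forall r, D r -> Rabs (r - s) < d -> f r < c.
Proof.
  intros Hf Ds Hs.
  destruct (proj1 (continuous_on_eps D f) Hf s Ds (c - f s)) as [d [Hd H]];
    [lra|].
  exists d; split; [assumption|]. intros r Dr Hr.
  generalize (H r Dr Hr). intros H1. apply Rabs_lt_between in H1. lra.
Qed.

(** A one-sided Gronwall argument. If w r < 0, let s0 be the last time before r
    with w s0 >= 0. From s0 on w is negative, so exp (- K s) * w s has a nonnegative
    derivative there, although it would have to go from a nonnegative to a
    negative value. Since the differential inequality is only asked where w is
    negative, the same lemma serves for uniqueness and for comparison of
    solutions. *)
Lemma barrier (K r : R) (w dw : R -> R) :
  0 <= r -> continuous_on (Icc 0 r) w ->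
  (forall s, 0 < s < r -> is_derive w s (dw s)) ->
  (forall s, 0 < s < r -> w s < 0 -> K * w s <= dw s) ->
  0 <= w 0 -> 0 <= w r.
Proof.
  intros Hr Hc Hd Hn H0.
  destruct (Rle_lt_dec 0 (w r)) as [|Hw]; [assumption|exfalso].
  destruct (completeness (fun s => 0 <= s <= r /\ 0 <= w s)) as [s0 [Hub Hlub]].
  { exists r. intros s [Hs _]; lra. }
  { exists 0. split; [lra|assumption]. }
  assert (Hs0 : 0 <= s0 <= r).
  { split; [apply Hub; split; [lra|assumption]|].
    apply Hlub. intros s [Hs _]; lra. }
  assert (Hneg : forall s, s0 < s <= r -> w s < 0).
  { intros s Hs. destruct (Rlt_le_dec (w s) 0) as [|H]; [assumption|].
    assert (s <= s0) by (apply Hub; split; lra). lra. }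
  assert (Hw0 : 0 <= w s0).
  { destruct (Rle_lt_dec 0 (w s0)) as [|H]; [assumption|exfalso].
    destruct (continuous_on_near_lt _ w s0 0 Hc Hs0 H) as [d [Hd0 Hnear]].
    assert (s0 <= s0 - d); [|lra].
    apply Hlub. intros s [Hs Hws].
    destruct (Rle_lt_dec s (s0 - d)) as [|Hlt]; [assumption|exfalso].
    assert (s <= s0) by (apply Hub; split; assumption).
    assert (w s < 0); [|lra].
    apply Hnear; [assumption|]. rewrite Rabs_left1; lra. }
  assert (s0 < r).
  { destruct (Req_dec s0 r) as [E|]; [rewrite E in Hw0; lra|lra]. }
  assert (exp (- K * s0) * w s0 <= exp (- K * r) * w r).
  { apply (nondecreasing_of_derive s0 r (fun s => exp (- K * s) * w s)
      (fun s => exp (- K * s) * (dw s - K * w s))).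
    - lra.
    - apply (continuous_on_subset (Icc 0 r) _).
      { unfold Icc; intros; lra. }
      apply continuous_on_mult; [|exact Hc].
      apply continuous_on_forall. intros x _.
      apply (is_derive_continuous _ x (- K * exp (- K * x))).
      auto_derive; [auto|ring].
    - intros s Hs. evar_last.
      + apply (is_derive_mult (fun s => exp (- K * s)) w s
                 (- K * exp (- K * s)) (dw s)).
        * auto_derive; [auto|ring].
        * apply Hd; lra.
        * intros; apply Rmult_comm.
      + unfold plus, mult; simpl. ring.
    - intros s Hs. apply Rmult_le_pos; [left; apply exp_pos|].
      assert (K * w s <= dw s) by (apply Hn; [lra|apply Hneg; lra]). lra. }
  pose proof (exp_pos (- K * s0)). pose proof (exp_pos (- K * r)).
  assert (0 <= exp (- K * s0) * w s0) by (apply Rmult_le_pos; lra).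
  assert (exp (- K * r) * w r < 0).
  { assert (0 < exp (- K * r) * - w r) by (apply Rmult_lt_0_compat; lra). lra. }
  lra.
Qed.

(** * Picard iteration *)

(** The clamp makes every iterate a function on the whole line, constant outside
    [0, T], so that all estimates are uniform in t. *)
Definition picard_step (T y : R) (F : R -> R -> R) (u : R -> R) (t : R) : R :=
  y + RInt (fun s => F s (u s)) 0 (clamp 0 T t).

Fixpoint picard (T y : R) (F : R -> R -> R) (n : nat) : R -> R :=
  match n with
  | O => fun _ => y
  | S m => picard_step T y F (picard T y F m)
  end.

Lemma ex_RInt_of_continuous (f : R -> R) (a b : R) :
  (forall t, continuous f t) -> ex_RInt f a b.
Proof.
  intros H. apply (ex_RInt_continuous (V := R_CompleteNormedModule)).
  intros z _. exact (H z).
Qed.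

Lemma is_derive_RInt_upper (f : R -> R) (a t : R) :
  (forall s, continuous f s) -> is_derive (fun r => RInt f a r) t (f t).
Proof.
  intros H. apply (is_derive_RInt (V := R_NormedModule) f _ a t); [|exact (H t)].
  apply filter_forall. intros r.
  apply (RInt_correct (V := R_CompleteNormedModule)).
  apply ex_RInt_of_continuous, H.
Qed.

Lemma continuous_comp_clamp (a b : R) (f : R -> R) :
  a <= b -> (forall t, continuous f t) ->
  forall t, continuous (fun s => f (clamp a b s)) t.
Proof.
  intros Hab H. apply continuous_clamp_comp; [assumption|].
  apply continuous_on_forall; intros ? _; apply H.
Qed.

Lemma continuous_const_plus (c : R) (f : R -> R) (t : R) :
  continuous f t -> continuous (fun s => c + f s) t.
Proof.
  intros H. apply (continuous_plus (V := R_NormedModule) (fun _ => c) f t).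
  - apply continuous_const.
  - exact H.
Qed.

Lemma geometric_small (c e : R) : 0 < e -> exists N, c / 2 ^ N < e.
Proof.
  intros He.
  destruct (pow_lt_1_zero (/ 2)) with (y := e / (Rabs c + 1)) as [N HN].
  - rewrite Rabs_right; lra.
  - apply Rdiv_lt_0_compat; [assumption|]. pose proof (Rabs_pos c); lra.
  - exists N. generalize (HN N (Nat.le_refl N)). rewrite pow_inv.
    assert (0 < / 2 ^ N) by (apply Rinv_0_lt_compat, pow_lt; lra).
    rewrite Rabs_right by lra. intros H1.
    pose proof (Rabs_pos c). pose proof (Rle_abs c).
    apply Rle_lt_trans with (Rabs c * / 2 ^ N).
    + apply Rmult_le_compat_r; lra.
    + apply Rle_lt_trans with ((Rabs c + 1) * / 2 ^ N).
      * apply Rmult_le_compat_r; lra.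
      * apply (Rmult_lt_compat_l (Rabs c + 1)) in H1; [|lra].
        replace ((Rabs c + 1) * (e / (Rabs c + 1))) with e in H1 by (field; lra).
        exact H1.
Qed.

(** The limit is named, not merely asserted to exist, so that a sequence of
    equations yields a sequence of solutions without an appeal to choice. *)
Definition picard_limit (T y : R) (F : R -> R -> R) (t : R) : R :=
  real (Lim_seq (fun n => picard T y F n t)).

Section Picard.

Variables (T y L B : R) (F : R -> R -> R).
Hypothesis HT : 0 <= T.
Hypothesis HL0 : 0 < L.
Hypothesis Fcont : forall u, (forall t, continuous u t) ->
  forall t, continuous (fun s => F s (u s)) t.
Hypothesis Flip : forall s p q, Rabs (F s p - F s q) <= L * Rabs (p - q).
Hypothesis Fbound : forall s p, Rabs (F s p) <= B.

Lemma picard_step_continuous (u : R -> R) :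
  (forall t, continuous u t) -> forall t, continuous (picard_step T y F u) t.
Proof.
  intros Hu t. unfold picard_step. apply continuous_const_plus.
  apply (continuous_comp_clamp 0 T (fun r => RInt (fun s => F s (u s)) 0 r) HT).
  intros r. eapply is_derive_continuous, is_derive_RInt_upper.
  apply Fcont, Hu.
Qed.

Lemma picard_continuous (n : nat) : forall t, continuous (picard T y F n) t.
Proof.
  induction n as [|n IH].
  - intros t. apply continuous_const.
  - apply picard_step_continuous, IH.
Qed.

Lemma picard_step_diff (u v g : R -> R) (t : R) :
  (forall s, continuous u s) -> (forall s, continuous v s) ->
  (forall s, continuous g s) ->
  (forall s, 0 <= s <= T -> Rabs (u s - v s) <= g s) ->
  Rabs (picard_step T y F u t - picard_step T y F v t)
  <= RInt (fun s => L * g s) 0 (clamp 0 T t).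
Proof.
  intros Hu Hv Hg H. unfold picard_step.
  set (r := clamp 0 T t).
  assert (Hr : 0 <= r <= T) by (apply clamp_in, HT).
  assert (Eu : ex_RInt (fun s => F s (u s)) 0 r)
    by (apply ex_RInt_of_continuous, Fcont, Hu).
  assert (Ev : ex_RInt (fun s => F s (v s)) 0 r)
    by (apply ex_RInt_of_continuous, Fcont, Hv).
  replace (y + RInt (fun s => F s (u s)) 0 r - (y + RInt (fun s => F s (v s)) 0 r))
    with (RInt (fun s => F s (u s) - F s (v s)) 0 r).
  2:{ rewrite (RInt_minus (V := R_CompleteNormedModule) _ _ 0 r Eu Ev :
        RInt (fun s => F s (u s) - F s (v s)) 0 r = _).
      unfold minus, plus, opp; simpl. ring. }
  assert (Ed : forall s, continuous (fun s => F s (u s) - F s (v s)) s).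
  { intros s. apply (continuous_minus (V := R_NormedModule)
      (fun s => F s (u s)) (fun s => F s (v s)) s);
    apply Fcont; assumption. }
  eapply Rle_trans; [apply abs_RInt_le; [lra|apply ex_RInt_of_continuous, Ed]|].
  apply RInt_le; [lra| | |].
  - apply ex_RInt_of_continuous. intros s.
    apply (continuous_comp (fun s => F s (u s) - F s (v s)) Rabs s);
      [apply Ed|apply (continuous_Rabs)].
  - apply ex_RInt_of_continuous. intros s.
    apply (continuous_scal_r (V := R_NormedModule) L g s), Hg.
  - intros s Hs. eapply Rle_trans; [apply Flip|].
    apply Rmult_le_compat_l; [lra|]. apply H; lra.
Qed.

(** The weight exp (2 L t) makes the Picard map a contraction with ratio 1/2 on
    all of [0, T] at once: integrating L exp (2 L s) from 0 to t returns at most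
    half of the weight at t. *)
Lemma picard_increment (n : nat) (t : R) :
  Rabs (picard T y F (S n) t - picard T y F n t)
  <= B * T * exp (2 * L * clamp 0 T t) / 2 ^ n.
Proof.
  revert t. induction n as [|n IH]; intros t.
  - simpl. unfold picard_step.
    set (r := clamp 0 T t).
    assert (Hr : 0 <= r <= T) by (apply clamp_in, HT).
    replace (y + RInt (fun s => F s y) 0 r - y) with (RInt (fun s => F s y) 0 r)
      by (unfold Rminus; rewrite Rplus_comm, <- Rplus_assoc, Rplus_opp_l, Rplus_0_l;
          reflexivity).
    assert (HB : 0 <= B)
      by (eapply Rle_trans; [apply Rabs_pos|apply (Fbound 0 0)]).
    eapply Rle_trans.
    { apply (abs_RInt_le_const (fun s => F s y) 0 r B); [lra| |].
      - apply ex_RInt_of_continuous, (Fcont (fun _ => y)).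
        intros s; apply continuous_const.
      - intros; apply Fbound. }
    assert (1 <= exp (2 * L * r)).
    { rewrite <- exp_0.
      destruct (Req_dec r 0) as [->|].
      - right; f_equal; ring.
      - left; apply exp_increasing. apply Rmult_lt_0_compat; lra. }
    assert ((r - 0) * B <= B * T).
    { rewrite (Rmult_comm B T). apply Rmult_le_compat_r; lra. }
    assert (B * T * 1 <= B * T * exp (2 * L * r)).
    { apply Rmult_le_compat_l; [apply Rmult_le_pos; lra|assumption]. }
    lra.
  - set (g := fun s => B * T / 2 ^ n * exp (2 * L * s)).
    assert (Hg : forall s, continuous g s).
    { intros s. apply (is_derive_continuous g s (2 * L * g s)).
      unfold g. auto_derive; [auto|ring]. }
    eapply Rle_trans.
    { apply (picard_step_diff (picard T y F (S n)) (picard T y F n) g t);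
        [apply picard_continuous|apply picard_continuous|exact Hg|].
      intros s Hs. eapply Rle_trans; [apply IH|].
      rewrite clamp_id by assumption. right. unfold g. unfold Rdiv. ring. }
    set (r := clamp 0 T t).
    assert (Hr : 0 <= r <= T) by (apply clamp_in, HT).
    assert (E : RInt (fun s => L * g s) 0 r = / 2 * g r - / 2 * g 0).
    { apply is_RInt_unique.
      apply (is_RInt_derive (V := R_CompleteNormedModule) (fun s => / 2 * g s)).
      - intros s _. unfold g. auto_derive; [auto|field].
        apply pow_nonzero; lra.
      - intros s _. apply (continuous_scal_r (V := R_NormedModule) L g s), Hg. }
    rewrite E.
    assert (HB : 0 <= B)
      by (eapply Rle_trans; [apply Rabs_pos|apply (Fbound 0 0)]).
    assert (0 <= g 0).
    { unfold g. apply Rmult_le_pos; [|left; apply exp_pos].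
      apply Rmult_le_pos; [apply Rmult_le_pos; lra|].
      left. apply Rinv_0_lt_compat, pow_lt. lra. }
    replace (B * T * exp (2 * L * r) / 2 ^ S n) with (/ 2 * g r); [lra|].
    unfold g. simpl. field. apply pow_nonzero; lra.
Qed.

Let increment_bound := B * T * exp (2 * L * T).

Lemma picard_increment_unif (n : nat) (t : R) :
  Rabs (picard T y F (S n) t - picard T y F n t) <= increment_bound / 2 ^ n.
Proof.
  eapply Rle_trans; [apply picard_increment|].
  apply Rmult_le_compat_r; [left; apply Rinv_0_lt_compat, pow_lt; lra|].
  unfold increment_bound. apply Rmult_le_compat_l.
  - apply Rmult_le_pos; [|lra].
    eapply Rle_trans; [apply Rabs_pos|apply (Fbound 0 0)].
  - assert (H : 2 * L * clamp 0 T t <= 2 * L * T).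
    { apply Rmult_le_compat_l; [lra|]. apply clamp_in, HT. }
    destruct H as [H| ->]; [left; apply exp_increasing, H|right; reflexivity].
Qed.

Lemma picard_tail (n k : nat) (t : R) :
  Rabs (picard T y F (n + k) t - picard T y F n t)
  <= 2 * increment_bound / 2 ^ n - 2 * increment_bound / 2 ^ (n + k).
Proof.
  induction k as [|k IH].
  - rewrite Nat.add_0_r. rewrite !Rminus_diag. rewrite Rabs_R0. lra.
  - rewrite Nat.add_succ_r.
    pose proof (picard_increment_unif (n + k) t) as H.
    replace (picard T y F (S (n + k)) t - picard T y F n t) with
      ((picard T y F (S (n + k)) t - picard T y F (n + k) t)
       + (picard T y F (n + k) t - picard T y F n t)) by ring.
    eapply Rle_trans; [apply Rabs_triang|].
    replace (2 * increment_bound / 2 ^ S (n + k)) with (increment_bound / 2 ^ (n + k)).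
    2:{ simpl. field. apply pow_nonzero; lra. }
    unfold Rdiv in *. lra.
Qed.

Lemma increment_bound_nonneg : 0 <= increment_bound.
Proof.
  unfold increment_bound. apply Rmult_le_pos; [|left; apply exp_pos].
  apply Rmult_le_pos; [|exact HT].
  eapply Rle_trans; [apply Rabs_pos|apply (Fbound 0 0)].
Qed.

Lemma geometric_nonneg (n : nat) : 0 <= 2 * increment_bound / 2 ^ n.
Proof.
  pose proof increment_bound_nonneg. apply Rmult_le_pos; [lra|].
  left. apply Rinv_0_lt_compat, pow_lt. lra.
Qed.

Lemma picard_dist (n m : nat) (t : R) : (n <= m)%nat ->
  Rabs (picard T y F m t - picard T y F n t) <= 2 * increment_bound / 2 ^ n.
Proof.
  intros H. replace m with (n + (m - n))%nat by lia.
  pose proof (picard_tail n (m - n) t).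
  pose proof (geometric_nonneg (n + (m - n))). lra.
Qed.

Lemma picard_limit_dist (n : nat) (t : R) :
  Rabs (picard_limit T y F t - picard T y F n t) <= 2 * increment_bound / 2 ^ n.
Proof.
  unfold picard_limit.
  assert (Hl : ex_finite_lim_seq (fun n => picard T y F n t)).
  { apply ex_lim_seq_cauchy_corr. intros e.
    destruct (geometric_small (2 * (2 * increment_bound)) e (cond_pos e)) as [N HN].
    exists N. intros p q Hp Hq.
    pose proof (picard_dist N p t Hp) as H1.
    pose proof (picard_dist N q t Hq) as H2.
    replace (picard T y F p t - picard T y F q t) with
      ((picard T y F p t - picard T y F N t)
       - (picard T y F q t - picard T y F N t)) by ring.
    eapply Rle_lt_trans; [apply Rabs_triang|]. rewrite Rabs_Ropp.
    unfold Rdiv in *. lra. }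
  destruct Hl as [l Hl]. rewrite (is_lim_seq_unique _ _ Hl). simpl.
  assert (Habs : is_lim_seq
    (fun m => Rabs (picard T y F m t - picard T y F n t))
    (Rabs (l - picard T y F n t))).
  { apply (is_lim_seq_abs (fun m => picard T y F m t - picard T y F n t)
             (Finite (l - picard T y F n t))).
    apply (is_lim_seq_minus' _ (fun _ => picard T y F n t)); [exact Hl|].
    apply is_lim_seq_const. }
  apply (is_lim_seq_le_loc _ (fun _ => 2 * increment_bound / 2 ^ n)
           (Finite (Rabs (l - picard T y F n t))) (Finite (2 * increment_bound / 2 ^ n)))
    in Habs; [exact Habs| |apply is_lim_seq_const].
  exists n. intros m Hm. apply picard_dist, Hm.
Qed.

Lemma picard_limit_continuous (t : R) : continuous (picard_limit T y F) t.
Proof.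
  apply continuity_pt_filterlim.
  apply (CVU_continuity (picard T y F) _ t (mkposreal 1 Rlt_0_1)).
  - intros e He. destruct (geometric_small (2 * increment_bound) e He) as [N HN].
    exists N. intros n s Hn _.
    eapply Rle_lt_trans; [apply picard_limit_dist|].
    eapply Rle_lt_trans; [|exact HN].
    apply Rmult_le_compat_l; [pose proof increment_bound_nonneg; lra|].
    apply Rinv_le_contravar; [apply pow_lt; lra|].
    apply Rle_pow; [lra|exact Hn].
  - intros n s _. apply continuity_pt_filterlim. apply picard_continuous.
  - unfold Boule; simpl. rewrite Rminus_diag, Rabs_R0. lra.
Qed.

Lemma picard_limit_fixpoint (t : R) :
  picard_limit T y F t = picard_step T y F (picard_limit T y F) t.
Proof.
  pose proof picard_limit_continuous as Hc.
  pose proof picard_limit_dist as Hu.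
  set (u := picard_limit T y F) in *.
  apply cond_eq. intros e He.
  assert (Hk : 0 < L * T + 1).
  { assert (0 <= L * T) by (apply Rmult_le_pos; lra). lra. }
  destruct (geometric_small (2 * increment_bound) (e / (L * T + 1))) as [N HN].
  { apply Rdiv_lt_0_compat; assumption. }
  replace (u t - picard_step T y F u t) with
    ((u t - picard T y F (S N) t)
     + - (picard_step T y F u t - picard_step T y F (picard T y F N) t))
    by (simpl; ring).
  eapply Rle_lt_trans; [apply Rabs_triang|]. rewrite Rabs_Ropp.
  pose proof (Hu (S N) t) as H1.
  assert (H2 : Rabs (picard_step T y F u t - picard_step T y F (picard T y F N) t)
               <= RInt (fun s => L * (fun _ => 2 * increment_bound / 2 ^ N) s) 0 (clamp 0 T t)).
  { apply (picard_step_diff u (picard T y F N) (fun _ => 2 * increment_bound / 2 ^ N) t);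
      [exact Hc|apply picard_continuous|intros; apply continuous_const|].
    intros s _. apply Hu. }
  cbv beta in H2. rewrite RInt_const in H2.
  pose proof (clamp_in 0 T t HT) as Hr.
  change (scal (clamp 0 T t - 0) (L * (2 * increment_bound / 2 ^ N)))
    with ((clamp 0 T t - 0) * (L * (2 * increment_bound / 2 ^ N))) in H2.
  pose proof (geometric_nonneg N) as Hg.
  pose proof increment_bound_nonneg.
  assert (H3 : 2 * increment_bound / 2 ^ S N <= 2 * increment_bound / 2 ^ N).
  { apply Rmult_le_compat_l; [lra|].
    apply Rinv_le_contravar; [apply pow_lt; lra|]. apply Rle_pow; [lra|lia]. }
  set (q := 2 * increment_bound / 2 ^ N) in *.
  assert (H4 : (clamp 0 T t - 0) * (L * q) <= T * (L * q)).
  { apply Rmult_le_compat_r; [apply Rmult_le_pos; lra|lra]. }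
  assert (H5 : (L * T + 1) * q < e).
  { apply (Rmult_lt_compat_l (L * T + 1)) in HN; [|exact Hk].
    replace ((L * T + 1) * (e / (L * T + 1))) with e in HN by (field; lra).
    exact HN. }
  lra.
Qed.

Lemma picard_limit_init : picard_limit T y F 0 = y.
Proof.
  rewrite picard_limit_fixpoint. unfold picard_step. rewrite clamp_id by lra.
  rewrite RInt_point. unfold zero; simpl. ring.
Qed.

Lemma picard_limit_derive (t : R) : 0 < t < T ->
  is_derive (picard_limit T y F) t (F t (picard_limit T y F t)).
Proof.
  pose proof picard_limit_continuous as Hc.
  pose proof picard_limit_fixpoint as Hu.
  set (u := picard_limit T y F) in *. intros Ht.
  apply (is_derive_ext_loc (fun r => y + RInt (fun s => F s (u s)) 0 r)).
  - generalize (clamp_locally_id 0 T t Ht). apply filter_imp.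
    intros q Hq. rewrite (Hu q). unfold picard_step. rewrite Hq. reflexivity.
  - evar_last.
    + apply (is_derive_plus (V := R_NormedModule) (fun _ => y)
               (fun r => RInt (fun s => F s (u s)) 0 r)).
      * apply (is_derive_const (V := R_NormedModule)).
      * apply is_derive_RInt_upper, Fcont, Hc.
    + unfold plus, zero; simpl. ring.
Qed.

End Picard.

(** * Comparison of real Loewner solutions *)

(** The real Loewner equation for points to the left of the driver, written with
    positive denominators: such points move to the right, towards xi. *)
Definition left_solution (t : R) (xi u : R -> R) : Prop :=
  continuous_on (fun s => 0 <= s < t) u /\
  (forall s, 0 <= s < t -> u s < xi s) /\
  (forall s, 0 < s < t -> is_derive u s (2 / (xi s - u s))).

(** The distance to the driver comes arbitrarily close to 0 at times
    approaching t from below. *)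
Definition absorbed_left (xi : R -> R) (x t : R) : Prop :=
  0 < t /\ exists u, u 0 = x /\ left_solution t xi u /\
    forall e d, 0 < e -> 0 < d ->
      exists s, 0 <= s < t /\ t - d < s /\ xi s - u s < e.

Lemma left_solution_restrict (t r : R) (xi u : R -> R) :
  r <= t -> left_solution t xi u -> left_solution r xi u.
Proof.
  intros Hr [H1 [H2 H3]]. split; [|split].
  - apply (continuous_on_subset (fun s => 0 <= s < t) _); [|exact H1].
    intros s Hs; lra.
  - intros s Hs; apply H2; lra.
  - intros s Hs; apply H3; lra.
Qed.

Lemma left_solution_gap (t r : R) (xi u : R -> R) :
  (forall s, continuous xi s) -> left_solution t xi u -> 0 <= r < t ->
  exists m, 0 < m /\ forall s, 0 <= s <= r -> m <= xi s - u s.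
Proof.
  intros Hxi [H1 [H2 _]] Hr.
  apply (positive_bounded_below 0 r (fun s => xi s - u s)); [lra| |].
  - apply continuous_on_minus; [apply continuous_on_forall; intros ? _; apply Hxi|].
    apply (continuous_on_subset (fun s => 0 <= s < t) _); [|exact H1].
    unfold Icc; intros; lra.
  - intros s Hs. assert (u s < xi s) by (apply H2; lra). lra.
Qed.

Lemma inverse_difference (p q : R) :
  0 < p -> 0 < q -> 2 / p - 2 / q = 2 / (p * q) * (q - p).
Proof. intros. field. lra. Qed.

(** The difference w = v - u satisfies
    w' = 2 (w + xi - eta) / ((eta - v) (xi - u)), whose denominator is positive
    and bounded away from 0 on compact time intervals. By [barrier] w stays
    nonnegative, and then w' is nonnegative as well. Thus the lower point never
    catches up with the higher one, and the gap even grows; all the monotonicity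
    of hitting times comes from this. *)
Lemma gap_nondecreasing (t : R) (xi eta u v : R -> R) :
  (forall s, continuous xi s) -> (forall s, continuous eta s) ->
  left_solution t xi u -> left_solution t eta v ->
  (forall s, 0 <= s < t -> eta s <= xi s) -> u 0 <= v 0 ->
  forall r, 0 <= r < t -> v 0 - u 0 <= v r - u r.
Proof.
  intros Cxi Ceta Su Sv Hle H0.
  assert (Hc : forall r, 0 <= r < t -> continuous_on (Icc 0 r) (fun s => v s - u s)).
  { intros r Hr. destruct Su as [Cu _], Sv as [Cv _].
    apply (continuous_on_subset (fun s => 0 <= s < t) _).
    - unfold Icc; intros; lra.
    - apply continuous_on_minus; assumption. }
  assert (Hd : forall s, 0 < s < t -> is_derive (fun s => v s - u s) s
    (2 / ((eta s - v s) * (xi s - u s)) * ((xi s - u s) - (eta s - v s)))).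
  { intros s Hs. destruct Su as [_ [Lu Du]], Sv as [_ [Lv Dv]].
    assert (u s < xi s) by (apply Lu; lra). assert (v s < eta s) by (apply Lv; lra).
    rewrite <- inverse_difference by lra.
    apply (is_derive_minus (V := R_NormedModule) v u s); [apply Dv|apply Du]; lra. }
  assert (Hpos : forall s, 0 <= s < t -> 0 < 2 / ((eta s - v s) * (xi s - u s))).
  { intros s Hs. destruct Su as [_ [Lu _]], Sv as [_ [Lv _]].
    assert (u s < xi s) by (apply Lu; lra). assert (v s < eta s) by (apply Lv; lra).
    apply Rdiv_lt_0_compat; [lra|]. apply Rmult_lt_0_compat; lra. }
  assert (Hw : forall r, 0 <= r < t -> 0 <= v r - u r).
  { intros r Hr.
    destruct (left_solution_gap t r xi u Cxi Su Hr) as [m [Hm Hmle]].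
    destruct (left_solution_gap t r eta v Ceta Sv Hr) as [n [Hn Hnle]].
    apply (barrier (2 / (n * m)) r (fun s => v s - u s)
      (fun s => 2 / ((eta s - v s) * (xi s - u s)) * ((xi s - u s) - (eta s - v s)))).
    - lra.
    - apply Hc, Hr.
    - intros s Hs. apply Hd; lra.
    - intros s Hs Hneg.
      assert (Hc2 : 0 < 2 / ((eta s - v s) * (xi s - u s))) by (apply Hpos; lra).
      assert (Hle2 : eta s <= xi s) by (apply Hle; lra).
      assert (HK : 2 / ((eta s - v s) * (xi s - u s)) <= 2 / (n * m)).
      { apply Rmult_le_compat_l; [lra|]. apply Rinv_le_contravar.
        - apply Rmult_lt_0_compat; assumption.
        - assert (n <= eta s - v s) by (apply Hnle; lra).
          assert (m <= xi s - u s) by (apply Hmle; lra).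
          apply Rmult_le_compat; lra. }
      set (c := 2 / ((eta s - v s) * (xi s - u s))) in *.
      set (K := 2 / (n * m)) in *.
      apply Rle_trans with (c * (v s - u s)).
      + assert (0 <= (K - c) * - (v s - u s)) by (apply Rmult_le_pos; lra). lra.
      + apply Rmult_le_compat_l; lra.
    - lra. }
  intros r Hr.
  apply (nondecreasing_of_derive 0 r (fun s => v s - u s)
    (fun s => 2 / ((eta s - v s) * (xi s - u s)) * ((xi s - u s) - (eta s - v s)))).
  - lra.
  - apply Hc, Hr.
  - intros s Hs; apply Hd; lra.
  - intros s Hs. apply Rmult_le_pos; [left; apply Hpos; lra|].
    assert (0 <= v s - u s) by (apply Hw; lra).
    assert (eta s <= xi s) by (apply Hle; lra). lra.
Qed.

(** A point above an absorbed one, facing a driver that is lower, is squeezed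
    between the absorbed point and its own driver, hence cannot stay at a
    positive distance c from that driver. *)
Lemma absorbed_not_outlived (t c : R) (xi eta v : R -> R) (x : R) :
  (forall s, continuous xi s) -> (forall s, continuous eta s) ->
  absorbed_left xi x t -> left_solution t eta v ->
  (forall s, 0 <= s < t -> eta s <= xi s) -> x <= v 0 -> 0 < c ->
  (forall s, 0 <= s < t -> c <= eta s - v s) -> False.
Proof.
  intros Cxi Ceta [Ht [u [Hu0 [Su Hu]]]] Sv Hle Hx Hc Hv.
  destruct (Hu c 1 Hc Rlt_0_1) as [s [Hs [_ Hsc]]].
  assert (H : v 0 - u 0 <= v s - u s)
    by (apply (gap_nondecreasing t xi eta u v); auto; lra).
  assert (eta s <= xi s) by auto. assert (c <= eta s - v s) by auto. lra.
Qed.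

Lemma absorbed_left_unique (xi : R -> R) (x s t : R) :
  (forall r, continuous xi r) ->
  absorbed_left xi x s -> absorbed_left xi x t -> s = t.
Proof.
  intros Cxi.
  assert (H : forall s t, absorbed_left xi x s -> absorbed_left xi x t -> ~ s < t).
  { intros s' t' As [_ [v [Hv [Sv _]]]] Hst.
    destruct (left_solution_gap t' s' xi v Cxi Sv) as [m [Hm Hml]].
    { destruct As; lra. }
    apply (absorbed_not_outlived s' m xi xi v x); auto.
    - apply (left_solution_restrict t'); [lra|exact Sv].
    - intros; lra.
    - lra.
    - intros r Hr; apply Hml; lra. }
  intros As At. pose proof (H s t As At). pose proof (H t s At As). lra.
Qed.

(** Two points absorbed at the same time would have a gap shrinking to 0, while
    the gap is nondecreasing; if the upper one lasted longer, it would have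
    passed its driver. *)
Lemma absorbed_left_strict (xi : R -> R) (x y s t : R) :
  (forall r, continuous xi r) -> x < y ->
  absorbed_left xi x t -> absorbed_left xi y s -> s < t.
Proof.
  intros Cxi Hxy [Ht [u [Hu0 [Su Hu]]]] [Hs [v [Hv0 [Sv _]]]].
  destruct (Rlt_le_dec s t) as [|Hts]; [assumption|exfalso].
  destruct (Hu (y - x) 1) as [r [Hr [_ Hrc]]]; [lra|lra|].
  assert (Sv' := left_solution_restrict s t xi v Hts Sv).
  assert (H : v 0 - u 0 <= v r - u r).
  { apply (gap_nondecreasing t xi xi u v); auto; intros; lra. }
  destruct Sv' as [_ [Lv _]]. assert (v r < xi r) by auto. lra.
Qed.

(** * Existence up to absorption *)

(** The Loewner vector field with its singularity removed: it is bounded,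
    Lipschitz in the space variable, and agrees with the original one as long as
    the distance to the driver is at least d. *)
Definition truncated (d : R) (xi : R -> R) (s p : R) : R :=
  2 / Rmax (xi s - p) d.

Lemma truncated_monotone_lipschitz (d : R) (xi : R -> R) (s p q : R) :
  0 < d -> p <= q ->
  0 <= truncated d xi s q - truncated d xi s p <= 2 / (d * d) * (q - p).
Proof.
  intros Hd Hpq. unfold truncated.
  set (b := Rmax (xi s - q) d). set (a := Rmax (xi s - p) d).
  assert (Hb : d <= b) by apply Rmax_r.
  assert (Ha : d <= a) by apply Rmax_r.
  assert (Hab : 0 <= a - b <= q - p).
  { unfold a, b, Rmax. repeat destruct Rle_dec; lra. }
  rewrite inverse_difference by lra.
  assert (Hba : 0 < b * a) by (apply Rmult_lt_0_compat; lra).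
  assert (Hdd : 0 < d * d) by (apply Rmult_lt_0_compat; lra).
  assert (0 < 2 / (b * a)) by (apply Rdiv_lt_0_compat; lra).
  assert (2 / (b * a) <= 2 / (d * d)).
  { apply Rmult_le_compat_l; [lra|]. apply Rinv_le_contravar; [assumption|].
    apply Rmult_le_compat; lra. }
  split; [apply Rmult_le_pos; lra|].
  apply Rmult_le_compat; lra.
Qed.

Lemma truncated_lipschitz (d : R) (xi : R -> R) (s p q : R) :
  0 < d ->
  Rabs (truncated d xi s p - truncated d xi s q) <= 2 / (d * d) * Rabs (p - q).
Proof.
  intros Hd. destruct (Rle_lt_dec p q) as [H|H].
  - pose proof (truncated_monotone_lipschitz d xi s p q Hd H).
    rewrite !Rabs_left1 by lra. lra.
  - pose proof (truncated_monotone_lipschitz d xi s q p Hd (Rlt_le _ _ H)).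
    rewrite !Rabs_right by lra. lra.
Qed.

Lemma truncated_bounded (d : R) (xi : R -> R) (s p : R) :
  0 < d -> Rabs (truncated d xi s p) <= 2 / d.
Proof.
  intros Hd. unfold truncated.
  assert (d <= Rmax (xi s - p) d) by apply Rmax_r.
  rewrite Rabs_right.
  - apply Rmult_le_compat_l; [lra|]. apply Rinv_le_contravar; assumption.
  - apply Rle_ge. left. apply Rdiv_lt_0_compat; lra.
Qed.

Lemma truncated_continuous (d : R) (xi u : R -> R) :
  0 < d -> (forall t, continuous xi t) -> (forall t, continuous u t) ->
  forall t, continuous (fun s => truncated d xi s (u s)) t.
Proof.
  intros Hd Hxi Hu t. unfold truncated.
  assert (d <= Rmax (xi t - u t) d) by apply Rmax_r.
  apply (continuous_mult (K := R_AbsRing) (fun _ => 2)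
           (fun s => / Rmax (xi s - u s) d) t); [apply continuous_const|].
  apply (continuous_comp (fun s => Rmax (xi s - u s) d) Rinv t).
  - apply (continuous_comp (fun s => xi s - u s) (fun p => Rmax p d) t).
    + apply (continuous_minus (V := R_NormedModule) xi u t); auto.
    + intros P [e He]. exists e. intros y Hy. apply He.
      eapply Rle_lt_trans; [|exact Hy].
      change (Rabs (Rmax y d - Rmax (xi t - u t) d) <= Rabs (y - (xi t - u t))).
      unfold Rmax, Rabs. repeat destruct Rle_dec; repeat destruct Rcase_abs; lra.
  - apply continuous_Rinv. lra.
Qed.

Lemma truncated_unique (d r : R) (xi p q : R -> R) :
  0 < d -> 0 <= r ->
  continuous_on (Icc 0 r) p -> continuous_on (Icc 0 r) q -> p 0 = q 0 ->
  (forall s, 0 < s < r -> is_derive p s (truncated d xi s (p s))) ->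
  (forall s, 0 < s < r -> is_derive q s (truncated d xi s (q s))) ->
  p r = q r.
Proof.
  intros Hd Hr.
  assert (H : forall p q : R -> R,
    continuous_on (Icc 0 r) p -> continuous_on (Icc 0 r) q -> p 0 = q 0 ->
    (forall s, 0 < s < r -> is_derive p s (truncated d xi s (p s))) ->
    (forall s, 0 < s < r -> is_derive q s (truncated d xi s (q s))) ->
    0 <= p r - q r).
  { clear p q. intros p q Cp Cq E Dp Dq.
    apply (barrier (2 / (d * d)) r (fun s => p s - q s)
      (fun s => truncated d xi s (p s) - truncated d xi s (q s))).
    - exact Hr.
    - apply continuous_on_minus; assumption.
    - intros s Hs.
      apply (is_derive_minus (V := R_NormedModule) p q s); auto.
    - intros s Hs Hneg.
      destruct (truncated_monotone_lipschitz d xi s (p s) (q s) Hd); lra.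
    - lra. }
  intros Cp Cq E Dp Dq.
  pose proof (H p q Cp Cq E Dp Dq). pose proof (H q p Cq Cp (eq_sym E) Dq Dp).
  lra.
Qed.

Section Existence.

Variables (T y : R) (xi : R -> R).
Hypothesis HT : 0 < T.
Hypothesis Cxi : forall t, continuous xi t.
Hypothesis Hy : y < xi 0.

Let level (n : nat) : R := / (INR n + 1).
Let approx (n : nat) : R -> R := picard_limit T y (truncated (level n) xi).

Lemma level_pos (n : nat) : 0 < level n.
Proof. apply Rinv_0_lt_compat. pose proof (pos_INR n); lra. Qed.

Lemma level_antitone (n m : nat) : (n <= m)%nat -> level m <= level n.
Proof.
  intros H. apply Rinv_le_contravar.
  - pose proof (pos_INR n); lra.
  - apply le_INR in H; lra.
Qed.

Lemma level_small (e : R) : 0 < e -> exists n, level n < e.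
Proof.
  intros He. destruct (archimed_cor1 e He) as [n [Hn Hn0]].
  exists n. eapply Rle_lt_trans; [|exact Hn].
  apply Rinv_le_contravar; [apply lt_0_INR; assumption|lra].
Qed.

Lemma approximant_spec (n : nat) :
  (forall t, continuous (approx n) t) /\ approx n 0 = y /\
  (forall t, 0 < t < T ->
     is_derive (approx n) t (truncated (level n) xi t (approx n t))).
Proof.
  pose proof (level_pos n) as Hd.
  assert (HL : 0 < 2 / (level n * level n)).
  { apply Rdiv_lt_0_compat; [lra|]. apply Rmult_lt_0_compat; lra. }
  assert (HF : forall u, (forall t, continuous u t) -> forall t,
    continuous (fun s => truncated (level n) xi s (u s)) t).
  { intros u Hu. apply truncated_continuous; assumption. }
  assert (HLip := fun s p q => truncated_lipschitz (level n) xi s p q Hd).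
  assert (HB := fun s p => truncated_bounded (level n) xi s p Hd).
  assert (HT0 : 0 <= T) by lra.
  split; [|split].
  - exact (picard_limit_continuous T y _ _ _ HT0 HL HF HLip HB).
  - exact (picard_limit_init T y _ _ _ HT0 HL HF HLip HB).
  - exact (picard_limit_derive T y _ _ _ HT0 HL HF HLip HB).
Qed.

(** Under this condition the truncation is inactive on [0, s], so the n-th
    approximant solves the Loewner equation itself there. *)
Let Clear (n : nat) (s : R) : Prop :=
  0 <= s <= T /\ forall r, 0 <= r <= s -> level n < xi r - approx n r.

Lemma truncated_inactive (d s p : R) :
  d < xi s - p -> truncated d xi s p = 2 / (xi s - p).
Proof. intros H. unfold truncated. rewrite Rmax_left; lra. Qed.

(** As long as the coarser truncation is inactive, so is the finer one, and both
    approximants solve the same Lipschitz equation. *)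
Lemma clear_agree (n m : nat) (s : R) :
  Clear n s -> (n <= m)%nat -> forall r, 0 <= r <= s -> approx m r = approx n r.
Proof.
  intros [Hs HG] Hnm r Hr.
  destruct (approximant_spec n) as [Cn [In Dn]].
  destruct (approximant_spec m) as [Cm [Im Dm]].
  pose proof (level_antitone n m Hnm).
  apply (truncated_unique (level m) r xi).
  - apply level_pos.
  - lra.
  - apply continuous_on_forall; intros; apply Cm.
  - apply continuous_on_forall; intros; apply Cn.
  - rewrite In, Im; reflexivity.
  - intros q Hq. apply Dm; lra.
  - intros q Hq. assert (level n < xi q - approx n q) by (apply HG; lra).
    rewrite truncated_inactive by lra.
    rewrite <- (truncated_inactive (level n)) by lra. apply Dn; lra.
Qed.

Lemma clear_open (n : nat) (s : R) :
  Clear n s -> s < T -> exists s', s < s' /\ Clear n s'.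
Proof.
  intros [Hs HG] HsT. destruct (approximant_spec n) as [Cn _].
  destruct (continuous_on_near_lt (fun _ => True)
    (fun r => approx n r - xi r) s (- level n))
    as [d [Hd H]].
  - apply continuous_on_forall. intros x _.
    apply (continuous_minus (V := R_NormedModule) (approx n) xi x); auto.
  - exact I.
  - assert (level n < xi s - approx n s) by (apply HG; lra). lra.
  - exists (Rmin T (s + d / 2)).
    pose proof (Rmin_l T (s + d / 2)). pose proof (Rmin_r T (s + d / 2)).
    assert (s < Rmin T (s + d / 2)) by (apply Rmin_glb_lt; lra).
    split; [assumption|]. split; [lra|]. intros r Hr.
    destruct (Rle_lt_dec r s); [apply HG; lra|].
    assert (approx n r - xi r < - level n); [|lra].
    apply H; [exact I|]. rewrite Rabs_right; lra.
Qed.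

Lemma clear_zero : exists n, Clear n 0.
Proof.
  destruct (level_small (xi 0 - y)) as [n Hn]; [lra|].
  exists n. split; [lra|]. intros r Hr. replace r with 0 by lra.
  destruct (approximant_spec n) as [_ [-> _]]. exact Hn.
Qed.

(** For s before the absorption time, the sequence is eventually constant. *)
Let limit (s : R) : R := real (Lim_seq (fun n => approx n s)).

Lemma clear_limit (n : nat) (s r : R) :
  Clear n s -> 0 <= r <= s -> limit r = approx n r.
Proof.
  intros HG Hr. unfold limit.
  rewrite (is_lim_seq_unique _ (Finite (approx n r))); [reflexivity|].
  apply (is_lim_seq_ext_loc (fun _ => approx n r)); [|apply is_lim_seq_const].
  exists n. intros m Hm. symmetry. apply (clear_agree n m s); assumption.
Qed.

Lemma clear_left_solution (s0 : R) :
  (forall s, 0 <= s < s0 -> exists n, Clear n s) -> left_solution s0 xi limit.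
Proof.
  intros HE.
  assert (Hloc : forall s, 0 <= s < s0 -> exists n s', s < s' /\ Clear n s').
  { intros s Hs. destruct (HE ((s + s0) / 2)) as [n Hn]; [lra|].
    exists n, ((s + s0) / 2). split; [lra|exact Hn]. }
  split; [|split].
  - apply continuous_on_eps. intros s Hs e He.
    destruct (Hloc s Hs) as [n [s' [Hss' HG]]].
    destruct (approximant_spec n) as [Cn _].
    assert (Cn' : continuous_on (fun s => 0 <= s < s0) (approx n))
      by (apply continuous_on_forall; auto).
    destruct (proj1 (continuous_on_eps _ _) Cn' s Hs e He) as [d [Hd H]].
    exists (Rmin d (s' - s)). split; [apply Rmin_pos; lra|].
    intros r Hr Hrs.
    pose proof (Rmin_l d (s' - s)). pose proof (Rmin_r d (s' - s)).
    pose proof (Rle_abs (r - s)).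
    rewrite (clear_limit n s' r HG), (clear_limit n s' s HG) by lra.
    apply H; [assumption|lra].
  - intros s Hs. destruct (HE s Hs) as [n HG].
    rewrite (clear_limit n s s HG) by lra.
    assert (level n < xi s - approx n s) by (apply HG; lra).
    pose proof (level_pos n). lra.
  - intros s Hs. destruct (Hloc s) as [n [s' [Hss' HG]]]; [lra|].
    rewrite (clear_limit n s' s HG) by lra.
    assert (level n < xi s - approx n s) by (apply HG; lra).
    destruct HG as [HsT HG'].
    apply (is_derive_ext_loc (approx n)).
    + generalize (clamp_locally_id 0 s' s ltac:(lra)). apply filter_imp.
      intros r Hr. symmetry. apply (clear_limit n s'); [split; assumption|].
      rewrite <- Hr. apply clamp_in; lra.
    + destruct (approximant_spec n) as [_ [_ Dn]].
      rewrite <- (truncated_inactive (level n)) by assumption.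
      apply Dn; lra.
Qed.

(** Maximal solutions: let s0 be the supremum of the times up to which some
    truncation stays inactive. If this is not the whole interval, the solution
    built up to s0 has to approach the driver there: were it to stay at distance
    e from it near s0, a truncation at a level below e would be inactive up to
    s0 and, by continuity, beyond. *)
Lemma absorbed_or_survives :
  (exists s, 0 < s <= T /\ absorbed_left xi y s) \/
  (exists v c, v 0 = y /\ left_solution T xi v /\ 0 < c /\
     forall s, 0 <= s < T -> c <= xi s - v s).
Proof.
  set (E := fun s => exists n, Clear n s).
  assert (Edown : forall s r, E s -> 0 <= r <= s -> E r).
  { intros s r [n [Hs HG]] Hr. exists n. split; [lra|].
    intros q Hq; apply HG; lra. }
  assert (Elim0 : limit 0 = y).
  { destruct clear_zero as [n Hn]. rewrite (clear_limit n 0 0 Hn) by lra.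
    apply approximant_spec. }
  destruct (classic (E T)) as [[n HG]|HnT].
  { right. exists limit, (level n). split; [exact Elim0|split].
    - apply clear_left_solution. intros s Hs.
      apply (Edown T); [exists n; exact HG|lra].
    - split; [apply level_pos|]. intros s Hs.
      rewrite (clear_limit n T s HG) by lra. left. apply HG. lra. }
  left.
  destruct (completeness E) as [s0 [Hub Hlub]].
  { exists T. intros s [n [Hs _]]; lra. }
  { exists 0. exact clear_zero. }
  assert (Hs0T : s0 <= T) by (apply Hlub; intros s [n [Hs _]]; lra).
  assert (HnE : ~ E s0).
  { intros HE. destruct (Req_dec s0 T) as [->|]; [contradiction|].
    destruct HE as [n HG]. destruct (clear_open n s0 HG) as [s' [Hs' HG']]; [lra|].
    assert (s' <= s0) by (apply Hub; exists n; assumption). lra. }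
  assert (Hs0 : 0 < s0).
  { destruct clear_zero as [n Hn].
    assert (0 <= s0) by (apply Hub; exists n; exact Hn).
    destruct (Req_dec s0 0) as [H0|]; [|lra].
    exfalso. apply HnE. rewrite H0. exists n; exact Hn. }
  assert (HE : forall s, 0 <= s < s0 -> E s).
  { intros s Hs. destruct (classic (E s)) as [|Hn]; [assumption|exfalso].
    assert (s0 <= s); [|lra]. apply Hlub. intros r Hr.
    destruct (Rle_lt_dec r s) as [|Hsr]; [assumption|exfalso].
    apply Hn, (Edown r); [assumption|lra]. }
  pose proof (clear_left_solution s0 HE) as HV.
  exists s0. split; [lra|]. split; [assumption|]. exists limit.
  split; [exact Elim0|split; [exact HV|]].
  intros e d He Hd.
  apply NNPP. intros Hno.
  assert (Hfar : forall s, 0 <= s < s0 -> s0 - d < s -> e <= xi s - limit s).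
  { intros s Hs Hsd. destruct (Rle_lt_dec e (xi s - limit s)) as [|Hlt]; [assumption|].
    exfalso. apply Hno. exists s. auto. }
  set (r0 := Rmax 0 (s0 - d / 2)).
  assert (Hr0 : 0 <= r0 < s0 /\ s0 - d < r0).
  { unfold r0, Rmax. destruct Rle_dec; lra. }
  destruct (HE r0) as [n Hn]; [lra|].
  destruct (level_small e He) as [k Hk].
  set (m := max n k).
  assert (Hm1 : level m <= level n) by (apply level_antitone; lia).
  assert (Hm2 : level m <= level k) by (apply level_antitone; lia).
  assert (Hdm : forall s, 0 <= s < s0 -> level m < xi s - limit s).
  { intros s Hs. destruct (Rle_lt_dec s r0).
    - rewrite (clear_limit n r0 s Hn) by lra.
      assert (level n < xi s - approx n s) by (apply Hn; lra). lra.
    - assert (e <= xi s - limit s) by (apply Hfar; lra). lra. }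
  destruct (approximant_spec m) as [Cm [Im Dm]].
  assert (HVU : forall s, 0 <= s < s0 -> limit s = approx m s).
  { intros s Hs. destruct HV as [CV [_ DV]].
    apply (truncated_unique (level m) s xi).
    - apply level_pos.
    - lra.
    - apply (continuous_on_subset (fun s => 0 <= s < s0) _); [|exact CV].
      unfold Icc; intros; lra.
    - apply continuous_on_forall; intros; apply Cm.
    - rewrite Elim0, Im. reflexivity.
    - intros q Hq. rewrite truncated_inactive by (apply Hdm; lra). apply DV; lra.
    - intros q Hq. apply Dm; lra. }
  apply HnE. exists m. split; [lra|]. intros r Hr.
  destruct (Rlt_le_dec r s0) as [Hrs|Hrs].
  - rewrite <- HVU by lra. apply Hdm; lra.
  - replace r with s0 by lra.
    destruct (Rlt_le_dec (xi s0 - approx m s0) e) as [Hlt|]; [exfalso|lra].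
    destruct (continuous_on_near_lt (fun _ => True) (fun r => xi r - approx m r) s0 e)
      as [b [Hb H]]; [|exact I|exact Hlt|].
    + apply continuous_on_forall. intros x _.
      apply (continuous_minus (V := R_NormedModule) xi (approx m) x); auto.
    + set (q := Rmax r0 (s0 - b / 2)).
      assert (Hq : r0 <= q < s0 /\ s0 - b < q).
      { unfold q, Rmax. destruct Rle_dec; lra. }
      assert (xi q - approx m q < e).
      { apply H; [exact I|]. rewrite Rabs_left1; lra. }
      assert (e <= xi q - limit q) by (apply Hfar; lra).
      rewrite HVU in *; lra.
Qed.

End Existence.

(** A higher starting point and a lower driver lead to an earlier absorption. The
    content is that absorption does take place: the solution from y exists until
    it is absorbed, and it cannot survive the one from x. *)
Lemma absorption_comparison (t : R) (xi eta : R -> R) (x y : R) :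
  (forall s, continuous xi s) -> (forall s, continuous eta s) ->
  absorbed_left xi x t -> (forall s, 0 <= s <= t -> eta s <= xi s) ->
  x <= y < eta 0 -> exists s, s <= t /\ absorbed_left eta y s.
Proof.
  intros Cxi Ceta Ax Hle Hy.
  destruct (absorbed_or_survives t y eta) as [[s [Hs As]]|[v [c [Hv [Sv [Hc Hg]]]]]].
  - apply Ax.
  - exact Ceta.
  - lra.
  - exists s. split; [lra|exact As].
  - exfalso. apply (absorbed_not_outlived t c xi eta v x); auto; [|lra].
    intros s Hs; apply Hle; lra.
Qed.

(** * Hitting times under perturbation of driver and point *)

(** A relational form of the finite values of [hitting_time], which does not
    mention the infimum nor the horizon T. *)
Definition reaches (xi : R -> R) (x t : R) : Prop :=
  (x = xi 0 /\ t = 0) \/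
  (x <> xi 0 /\ 0 < t /\ exists u, loewner_solution_R t xi x u /\
     is_LimInf_left (fun s => Rabs (u s - xi s)) t 0).

Lemma is_LimInf_left_abs (f : R -> R) (t : R) : 0 < t ->
  (is_LimInf_left (fun s => Rabs (f s)) t 0 <->
   forall e d, 0 < e -> 0 < d ->
     exists s, 0 < s < t /\ t - d < s /\ Rabs (f s) < e).
Proof.
  intros Ht. split.
  - intros H e d He Hd.
    destruct (H (mkposreal e He)) as [H1 _].
    assert (Hm : 0 < Rmin d t) by (apply Rmin_pos; assumption).
    destruct (H1 (mkposreal _ Hm)) as [s [Hs Hlt]]. simpl in Hs, Hlt.
    pose proof (Rmin_l d t). pose proof (Rmin_r d t).
    exists s. repeat split; lra.
  - intros H e. split.
    + intros d. destruct (H e d (cond_pos e) (cond_pos d)) as [s [Hs [Hd Hlt]]].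
      exists s. split; lra.
    + exists (mkposreal 1 Rlt_0_1). intros s _.
      pose proof (Rabs_pos (f s)). pose proof (cond_pos e). lra.
Qed.

Lemma reaches_nonneg (xi : R -> R) (x t : R) : reaches xi x t -> 0 <= t.
Proof. intros [[_ ->]|[_ [H _]]]; lra. Qed.

Lemma reaches_ext (T : R) (xi eta : R -> R) (x t : R) :
  (forall s, 0 <= s <= T -> xi s = eta s) -> 0 <= T -> t <= T ->
  reaches xi x t -> reaches eta x t.
Proof.
  intros E HT Ht [[Hx H0]|[Hx [H0 [u [[I [C [N D]]] L]]]]].
  - left. rewrite <- E by lra. auto.
  - right. split; [rewrite <- E by lra; exact Hx|]. split; [exact H0|].
    exists u. split.
    + split; [exact I|split; [exact C|split]].
      * intros s Hs. rewrite <- E by lra. auto.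
      * intros s Hs. rewrite <- E by lra. auto.
    + apply (is_LimInf_left_abs (fun s => u s - eta s)); [exact H0|].
      intros e d He Hd.
      destruct (proj1 (is_LimInf_left_abs (fun s => u s - xi s) t H0) L e d He Hd)
        as [s [Hs [Hsd Hlt]]].
      exists s. rewrite <- E by lra. auto.
Qed.

(** The equation is odd, so statements about points to the right of the driver
    are reflections of statements about points to its left. *)
Lemma reaches_opp (xi : R -> R) (x t : R) :
  reaches xi x t -> reaches (fun s => - xi s) (- x) t.
Proof.
  intros [[Hx H0]|[Hx [H0 [u [[I [C [N D]]] L]]]]].
  - left. rewrite Hx. auto.
  - right. split; [lra|]. split; [exact H0|].
    exists (fun s => - u s). split.
    + split; [rewrite I; reflexivity|split; [|split]].
      * apply continuous_on_eps. intros s Hs e He.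
        destruct (proj1 (continuous_on_eps _ _) C s Hs e He) as [d [Hd H]].
        exists d. split; [exact Hd|]. intros r Hr Hrs.
        replace (- u r - - u s) with (- (u r - u s)) by ring.
        rewrite Rabs_Ropp. auto.
      * intros s Hs. generalize (N s Hs). lra.
      * intros s Hs.
        replace (-2 / (- u s - - xi s)) with (- (-2 / (u s - xi s))).
        -- apply (is_derive_opp (V := R_NormedModule) u s). auto.
        -- assert (u s <> xi s) by (apply N; lra). field. lra.
    + apply (is_LimInf_left_abs (fun s => - u s - - xi s)); [exact H0|].
      intros e d He Hd.
      destruct (proj1 (is_LimInf_left_abs (fun s => u s - xi s) t H0) L e d He Hd)
        as [s [Hs [Hsd Hlt]]].
      exists s. replace (- u s - - xi s) with (- (u s - xi s)) by ring.
      rewrite Rabs_Ropp. auto.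
Qed.

Lemma reaches_opp_inv (xi : R -> R) (x t : R) :
  reaches (fun s => - xi s) (- x) t -> reaches xi x t.
Proof.
  intros H. apply reaches_opp in H. rewrite Ropp_involutive in H.
  apply (reaches_ext (Rmax 0 t) (fun s => - - xi s)); [| | |exact H].
  - intros; ring.
  - apply Rmax_l.
  - apply Rmax_r.
Qed.

Lemma reaches_left_iff (xi : R -> R) (x t : R) :
  (forall s, continuous xi s) -> x < xi 0 ->
  (reaches xi x t <-> absorbed_left xi x t).
Proof.
  intros Cxi Hx. split.
  - intros [[E _]|[_ [H0 [u [[I [C [N D]]] L]]]]]; [lra|].
    assert (Hlt : forall s, 0 <= s < t -> u s < xi s).
    { intros s Hs. assert (0 < xi s - u s); [|lra].
      apply (positive_of_nonzero 0 s (fun s => xi s - u s)); [lra| | |lra].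
      - apply continuous_on_minus.
        + apply continuous_on_forall; intros; apply Cxi.
        + apply (continuous_on_subset (fun s => 0 <= s < t) _); [|exact C].
          unfold Icc; intros; lra.
      - intros r Hr. assert (u r <> xi r) by (apply N; lra). lra. }
    split; [exact H0|]. exists u. split; [exact I|]. split.
    + split; [exact C|split; [exact Hlt|]]. intros s Hs.
      assert (u s < xi s) by (apply Hlt; lra).
      replace (2 / (xi s - u s)) with (-2 / (u s - xi s)) by (field; lra).
      apply D, Hs.
    + intros e d He Hd.
      destruct (proj1 (is_LimInf_left_abs (fun s => u s - xi s) t H0) L e d He Hd)
        as [s [Hs [Hsd Hs2]]].
      exists s. split; [lra|]. split; [exact Hsd|].
      apply Rabs_lt_between in Hs2. lra.
  - intros [H0 [u [I [[C [Hlt D]] L]]]]. right.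
    split; [lra|]. split; [exact H0|]. exists u. split.
    + split; [exact I|split; [exact C|split]].
      * intros s Hs. generalize (Hlt s Hs). lra.
      * intros s Hs. assert (u s < xi s) by (apply Hlt; lra).
        replace (-2 / (u s - xi s)) with (2 / (xi s - u s)) by (field; lra).
        apply D, Hs.
    + apply (is_LimInf_left_abs (fun s => u s - xi s)); [exact H0|].
      intros e d He Hd.
      assert (Hm : 0 < Rmin d t) by (apply Rmin_pos; assumption).
      destruct (L e (Rmin d t) He Hm) as [s [Hs [Hsd Hs2]]].
      pose proof (Rmin_l d t). pose proof (Rmin_r d t).
      exists s. split; [lra|]. split; [lra|].
      generalize (Hlt s Hs). intros. rewrite Rabs_left1; lra.
Qed.

Lemma absorbed_left_shift (d : R) (xi : R -> R) (x t : R) :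
  absorbed_left xi x t -> absorbed_left (fun s => xi s + d) (x + d) t.
Proof.
  intros [H0 [u [I [[C [Hlt D]] L]]]]. split; [exact H0|].
  exists (fun s => u s + d). split; [rewrite I; reflexivity|]. split; [split; [|split]|].
  - apply continuous_on_eps. intros s Hs e He.
    destruct (proj1 (continuous_on_eps _ _) C s Hs e He) as [b [Hb H]].
    exists b. split; [exact Hb|]. intros r Hr Hrs.
    replace (u r + d - (u s + d)) with (u r - u s) by ring. auto.
  - intros s Hs. generalize (Hlt s Hs). lra.
  - intros s Hs. replace (xi s + d - (u s + d)) with (xi s - u s) by ring.
    evar_last.
    + apply (is_derive_plus (V := R_NormedModule) u (fun _ => d) s); [apply D, Hs|].
      apply (is_derive_const (V := R_NormedModule)).
    + unfold plus, zero; simpl. ring.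
  - intros e b He Hb. destruct (L e b He Hb) as [s Hs]. exists s.
    replace (xi s + d - (u s + d)) with (xi s - u s) by ring. exact Hs.
Qed.

(** Only the values of the driver on [0, T] enter the equation, so it may be
    continued by constants to a function continuous on the whole line. *)
Lemma driver_extension (T : R) (xi : R -> R) :
  0 <= T -> driver T xi -> exists eta : R -> R,
  (forall s, continuous eta s) /\ forall s, 0 <= s <= T -> xi s = eta s.
Proof.
  intros HT Hxi. exists (fun s => xi (clamp 0 T s)). split.
  - apply continuous_clamp_comp; assumption.
  - intros s Hs. rewrite clamp_id by assumption. reflexivity.
Qed.

(** Translating driver and point together changes nothing, so a perturbation of
    the driver by at most d is compensated by moving the starting point by d; after
    the translation this is [absorption_comparison]. *)
Lemma reaches_shift_left (T d : R) (xi eta : R -> R) (x y t : R) :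
  0 <= T -> driver T xi -> driver T eta ->
  (forall s, 0 <= s <= T -> eta s <= xi s + d) ->
  t <= T -> reaches xi x t -> x + d <= y <= eta 0 ->
  exists s, s <= t /\ reaches eta y s.
Proof.
  intros HT Dxi Deta Hle Ht Hx Hy.
  assert (H0 : eta 0 <= xi 0 + d) by (apply Hle; lra).
  destruct (Req_dec y (eta 0)) as [E|Hne].
  { exists 0. split; [apply (reaches_nonneg _ _ _ Hx)|left; auto]. }
  destruct (driver_extension T xi HT Dxi) as [f [Cf Ef]].
  destruct (driver_extension T eta HT Deta) as [g [Cg Eg]].
  destruct (absorption_comparison t (fun s => f s + d) g (x + d) y)
    as [s [Hs As]].
  - intros s. apply (continuous_plus (V := R_NormedModule) f (fun _ => d) s);
      [apply Cf|apply continuous_const].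
  - exact Cg.
  - apply absorbed_left_shift. apply reaches_left_iff; [exact Cf| |].
    + rewrite <- Ef; lra.
    + apply (reaches_ext T xi); assumption.
  - intros s Hs. rewrite <- Ef, <- Eg by lra. apply Hle; lra.
  - rewrite <- Eg; lra.
  - exists s. split; [exact Hs|].
    apply (reaches_ext T g); [intros; symmetry; auto|exact HT|lra|].
    apply reaches_left_iff; [exact Cg|rewrite <- Eg; lra|exact As].
Qed.

Lemma driver_opp (T : R) (xi : R -> R) :
  driver T xi -> driver T (fun s => - xi s).
Proof.
  intros H. apply (continuous_on_ext (Icc 0 T) (fun s => 0 - xi s));
    [intros; apply Rminus_0_l|].
  apply continuous_on_minus; [|exact H].
  apply continuous_on_forall; intros; apply continuous_const.
Qed.

Lemma reaches_shift_right (T d : R) (xi eta : R -> R) (x y t : R) :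
  0 <= T -> driver T xi -> driver T eta ->
  (forall s, 0 <= s <= T -> xi s - d <= eta s) ->
  t <= T -> reaches xi x t -> eta 0 <= y <= x - d ->
  exists s, s <= t /\ reaches eta y s.
Proof.
  intros HT Dxi Deta Hle Ht Hx Hy.
  destruct (reaches_shift_left T d (fun s => - xi s) (fun s => - eta s)
              (- x) (- y) t) as [s [Hs As]];
    [exact HT|apply driver_opp, Dxi|apply driver_opp, Deta| |exact Ht
    |apply reaches_opp, Hx|lra|].
  - intros s Hs. generalize (Hle s Hs). lra.
  - exists s. split; [exact Hs|apply reaches_opp_inv, As].
Qed.

Lemma reaches_strict_left (T : R) (xi : R -> R) (x y s t : R) :
  0 <= T -> driver T xi -> s <= T -> t <= T -> x < y <= xi 0 ->
  reaches xi x t -> reaches xi y s -> s < t.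
Proof.
  intros HT Dxi Hs Ht Hxy Hx Hy.
  destruct (driver_extension T xi HT Dxi) as [f [Cf Ef]].
  apply (reaches_ext T xi f) in Hx; [|assumption..].
  apply (reaches_ext T xi f) in Hy; [|assumption..].
  rewrite Ef in Hxy by lra.
  assert (Ax : absorbed_left f x t) by (apply reaches_left_iff; [exact Cf|lra|exact Hx]).
  destruct (Req_dec y (f 0)) as [E|Hne].
  - destruct Hy as [[_ ->]|[Hn _]]; [apply Ax|contradiction].
  - apply (absorbed_left_strict f x y); [exact Cf|lra|exact Ax|].
    apply reaches_left_iff; [exact Cf|lra|exact Hy].
Qed.

Lemma reaches_strict_right (T : R) (xi : R -> R) (x y s t : R) :
  0 <= T -> driver T xi -> s <= T -> t <= T -> xi 0 <= x < y ->
  reaches xi x s -> reaches xi y t -> s < t.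
Proof.
  intros HT Dxi Hs Ht Hxy Hx Hy.
  apply (reaches_strict_left T (fun s => - xi s) (- y) (- x));
    [exact HT|apply driver_opp, Dxi|exact Hs|exact Ht|lra|apply reaches_opp, Hy
    |apply reaches_opp, Hx].
Qed.

Lemma reaches_unique_left (T : R) (xi : R -> R) (x s t : R) :
  0 <= T -> driver T xi -> s <= T -> t <= T -> x <= xi 0 ->
  reaches xi x s -> reaches xi x t -> s = t.
Proof.
  intros HT Dxi Hs Ht Hx H1 H2.
  destruct (Req_dec x (xi 0)) as [E|Hne].
  - destruct H1 as [[_ ->]|[Hn _]]; [|contradiction].
    destruct H2 as [[_ ->]|[Hn _]]; [reflexivity|contradiction].
  - destruct (driver_extension T xi HT Dxi) as [f [Cf Ef]].
    apply (reaches_ext T xi f) in H1; [|assumption..].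
    apply (reaches_ext T xi f) in H2; [|assumption..].
    rewrite Ef in Hne, Hx by lra.
    apply (absorbed_left_unique f x); [exact Cf| |];
      (apply reaches_left_iff; [exact Cf|lra|assumption]).
Qed.

Lemma reaches_unique (T : R) (xi : R -> R) (x s t : R) :
  0 <= T -> driver T xi -> s <= T -> t <= T ->
  reaches xi x s -> reaches xi x t -> s = t.
Proof.
  intros HT Dxi Hs Ht H1 H2. destruct (Rle_lt_dec x (xi 0)) as [Hx|Hx].
  - apply (reaches_unique_left T xi x); assumption.
  - apply (reaches_unique_left T (fun s => - xi s) (- x));
      [exact HT|apply driver_opp, Dxi|exact Hs|exact Ht|lra|apply reaches_opp, H1
      |apply reaches_opp, H2].
Qed.

(** A starting point reaches the driver at no more than one time, so the infimum
    defining the hitting time is over at most one element and is attained. *)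
Lemma hitting_time_reaches (T : R) (xi : R -> R) (x t : R) :
  0 <= T -> driver T xi ->
  (hitting_time T xi x = Finite t <-> t <= T /\ reaches xi x t).
Proof.
  intros HT Dxi. unfold hitting_time.
  destruct (Req_dec_T x (xi 0)) as [E|Hne].
  { split.
    - intros [= <-]. split; [exact HT|left; auto].
    - intros [_ [[_ ->]|[Hn _]]]; [reflexivity|contradiction]. }
  set (A := fun t => 0 < t <= T /\ exists u, loewner_solution_R t xi x u /\
              is_LimInf_left (fun s => Rabs (u s - xi s)) t 0).
  assert (HA : forall s, A s <-> s <= T /\ reaches xi x s).
  { intros s. unfold A, reaches. intuition. }
  assert (HG : forall s, s <= T /\ reaches xi x s -> Glb_Rbar A = Finite s).
  { intros s Hs. apply is_glb_Rbar_unique. split.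
    - intros r Hr. apply HA in Hr.
      assert (r = s) by (apply (reaches_unique T xi x); tauto).
      simpl; lra.
    - intros b Hb. apply Hb, HA, Hs. }
  split; [|apply HG].
  intros Ht. destruct (classic (exists s, A s)) as [[s Hs]|Hno].
  - apply HA in Hs. generalize (HG s Hs). rewrite Ht. intros [= ->]. exact Hs.
  - assert (Glb_Rbar A = p_infty).
    { apply is_glb_Rbar_unique. split.
      - intros r Hr. exfalso. apply Hno. exists r; exact Hr.
      - intros [b| |] _; simpl; auto. }
    congruence.
Qed.

(** * Stability of the welding *)

Lemma is_finite_eq (r : Rbar) (t : R) : r = Finite t -> is_finite r.
Proof. intros ->. reflexivity. Qed.

Lemma sup_norm_lt (T d : R) (f : R -> R) :
  Rbar_lt (sup_norm T f) (Finite d) -> forall t, 0 <= t <= T -> Rabs (f t) < d.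
Proof.
  intros H t Ht.
  apply (Rbar_le_lt_trans (Finite (Rabs (f t))) (sup_norm T f) (Finite d));
    [|exact H].
  apply (proj1 (Lub_Rbar_correct _)). exists t. auto.
Qed.

Theorem lemma4p6 (T : R) (xi : R -> R) (a b : R) (phi : R -> R) (x eps : R) :
  0 < T ->
  simple_curve_driver0 T xi ->
  is_conformal_welding T xi a b phi ->
  - a < x <= 0 ->
  0 < eps ->
  exists delta : R, 0 < delta /\
    forall (x' : R) (xi' : R -> R),
      x' <= 0 ->
      simple_curve_driver0 T xi' ->
      Rabs (x' - x) < delta ->
      Rbar_lt (sup_norm T (fun t => xi' t - xi t)) (Finite delta) ->
      is_finite (hitting_time T xi' x') /\
      forall (a' b' : R) (phi' : R -> R),
        is_conformal_welding T xi' a' b' phi' ->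
        - a' <= x' <= 0 /\ Rabs (phi' x' - phi x) < eps.
Proof.
  intros HT [[Dxi _] Hxi0] [Ha [Hb [Hfin [[Hphi [Cphi _]] Hweld]]]] Hx Heps.
  assert (HT0 : 0 <= T) by lra.
  assert (Hreach : forall z, - a <= z <= 0 ->
            exists t, t <= T /\ reaches xi z t /\ reaches xi (phi z) t).
  { intros z Hz. assert (F : is_finite (hitting_time T xi z)) by (apply Hfin; lra).
    exists (real (hitting_time T xi z)).
    destruct (proj1 (hitting_time_reaches T xi z (real (hitting_time T xi z))
                HT0 Dxi) (eq_sym F)) as [H1 H2].
    destruct (proj1 (hitting_time_reaches T xi (phi z) (real (hitting_time T xi z))
                HT0 Dxi)) as [_ H3].
    { rewrite Hweld by exact Hz. exact (eq_sym F). }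
    auto. }
  destruct (proj1 (continuous_on_eps _ _) Cphi x) with (e := eps / 2)
    as [d0 [Hd0 Hnear]]; [unfold Icc; lra|lra|].
  set (d1 := Rmin (eps / 2) (Rmin (d0 / 4) ((x + a) / 4))).
  assert (Hd1 : 0 < d1 /\ d1 <= eps / 2 /\ d1 <= d0 / 4 /\ d1 <= (x + a) / 4).
  { unfold d1, Rmin. repeat destruct Rle_dec; lra. }
  (* The point x + 2 delta must stay in [-a, 0]; it only occurs when x < 0. *)
  set (delta := if Rlt_dec x 0 then Rmin d1 (- x / 4) else d1).
  assert (Hdelta : 0 < delta <= d1 /\ (x < 0 -> delta <= - x / 4)).
  { unfold delta. destruct (Rlt_dec x 0); [|lra].
    unfold Rmin. destruct Rle_dec; lra. }
  exists delta. split; [apply Hdelta|].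
  intros x' xi' Hx' [[Dxi' _] Hxi0'] Hxx' Hsup.
  assert (Hclose : forall t, 0 <= t <= T -> Rabs (xi' t - xi t) < delta)
    by exact (sup_norm_lt T delta _ Hsup).
  apply Rabs_lt_between in Hxx'.
  assert (Hup : forall t, 0 <= t <= T -> xi' t <= xi t + delta).
  { intros t Ht. generalize (Hclose t Ht). intros H.
    apply Rabs_lt_between in H. lra. }
  assert (Hdown : forall t, 0 <= t <= T -> xi t <= xi' t + delta).
  { intros t Ht. generalize (Hclose t Ht). intros H.
    apply Rabs_lt_between in H. lra. }
  set (x1 := x - 2 * delta).
  destruct (Hreach x1) as [t1 [Ht1 [Rx1 Rphi1]]]; [unfold x1; lra|].
  assert (Hphi1 : Rabs (phi x1 - phi x) < eps / 2).
  { apply Hnear; [unfold Icc, x1; lra|].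
    unfold x1. rewrite Rabs_left1; lra. }
  apply Rabs_lt_between in Hphi1.
  destruct (reaches_shift_left T delta xi xi' x1 x' t1) as [t' [Ht' Rx']];
    [assumption..|unfold x1; lra|].
  assert (HtT : t' <= T) by lra.
  assert (Ehit : hitting_time T xi' x' = Finite t')
    by (apply hitting_time_reaches; auto).
  split; [exact (is_finite_eq _ _ Ehit)|].
  intros a' b' phi' [Ha' [Hb' [Hfin' [[Hphi' _] Hweld']]]].
  assert (Hax' : - a' <= x' <= 0).
  { split; [|exact Hx']. apply Hfin'. exact (is_finite_eq _ _ Ehit). }
  split; [exact Hax'|].
  assert (Hy' : 0 <= phi' x') by (apply Hphi'; exact Hax').
  assert (Ry' : reaches xi' (phi' x') t').
  { apply (hitting_time_reaches T); [assumption..|].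
    rewrite Hweld' by exact Hax'. exact Ehit. }
  assert (Hy1 : 0 <= phi x1) by (apply Hphi; unfold Icc, x1; lra).
  assert (Hy : 0 <= phi x) by (apply Hphi; unfold Icc; lra).
  apply Rabs_lt_between. split.
  - (* If phi' x' were too small, it would be hit too early: with z strictly
       between, tau' (phi' x') <= tau z < tau (phi x2) = tau x2 <= tau' x',
       where the two ends are equal. *)
    apply Rnot_le_lt. intros Hlow.
    (* For x = 0 the welding gives phi 0 = 0, and phi' x' is nonnegative. *)
    assert (Hxneg : x < 0).
    { destruct (Req_dec x 0) as [E|]; [exfalso|lra].
      destruct (Hreach 0) as [t0 [Ht0 [R0 Rphi0]]]; [lra|].
      assert (t0 = 0).
      { apply (reaches_unique T xi 0); auto. left; auto. }
      destruct Rphi0 as [[E0 _]|[_ [Hpos _]]]; [|lra].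
      rewrite E in Hlow. lra. }
    assert (Hdx : delta <= - x / 4) by (apply Hdelta; exact Hxneg).
    set (x2 := x + 2 * delta).
    destruct (Hreach x2) as [t2 [Ht2 [Rx2 Rphi2]]]; [unfold x2; lra|].
    assert (Hphi2 : Rabs (phi x2 - phi x) < eps / 2).
    { apply Hnear; [unfold Icc, x2; lra|].
      unfold x2. rewrite Rabs_right; lra. }
    apply Rabs_lt_between in Hphi2.
    destruct (reaches_shift_left T delta xi' xi x' x2 t') as [s2 [Hs2 Rs2]];
      [assumption..|unfold x2; lra|].
    assert (E2 : s2 = t2) by (apply (reaches_unique T xi x2); auto; lra).
    set (z := phi x - eps / 2).
    destruct (reaches_shift_right T 0 xi xi (phi x2) z t2) as [s3 [Hs3 Rs3]];
      [assumption..|intros; lra|assumption|assumption|unfold z; lra|].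
    assert (s3 < t2).
    { apply (reaches_strict_right T xi z (phi x2)); auto; unfold z; lra. }
    destruct (reaches_shift_right T delta xi xi' z (phi' x') s3) as [s4 [Hs4 Rs4]];
      [assumption..| |lra|assumption|unfold z; lra|].
    { intros s Hs. generalize (Hdown s Hs). lra. }
    assert (s4 = t') by (apply (reaches_unique T xi' (phi' x')); auto; lra).
    lra.
  - (* If phi' x' were too large, it would be hit too late:
       tau' x' <= tau x1 = tau (phi x1) < tau z <= tau' (phi' x'). *)
    apply Rnot_le_lt. intros Hhigh.
    set (z := phi x + eps / 2).
    destruct (reaches_shift_right T delta xi' xi (phi' x') z t') as [s [Hs Rs]];
      [assumption..| |assumption|assumption|unfold z; lra|].
    { intros s Hs. generalize (Hup s Hs). lra. }
    assert (t1 < s).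
    { apply (reaches_strict_right T xi (phi x1) z); auto; unfold z; lra. }
    lra.
Qed.
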